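(* Let $R$ be a ring, let $(P,Q,\psi)$ be an $R$-system satisfying condition (FS), and let $(S,T,\sigma,B)$ be a covariant representation of $(P,Q,\psi)$. Then there exist a unique ring homomorphism $\pi_{T,S}:\mathcal{F}_P(Q)\to B$ such that $\pi_{T,S}(\theta_{q,p})=T(q)S(p)$ for $p\in P$ and $q\in Q$, and a unique ring homomorphism $\chi_{S,T}:\mathcal{F}_Q(P)\to B^{op}$ such that $\chi_{S,T}(\theta_{p,q})=S(p)\cdot T(q)$ for $p\in P$ and $q\in Q$. These maps satisfy $$\pi_{T,S}(\Delta(r)\Theta)=\sigma(r)\pi_{T,S}(\Theta),\qquad \pi_{T,S}(\Theta\Delta(r))=\pi_{T,S}(\Theta)\sigma(r),$$ $$\chi_{S,T}(\Gamma(r)\Omega)=\sigma(r)\cdot\chi_{S,T}(\Omega),\qquad \chi_{S,T}(\Omega\Gamma(r))=\chi_{S,T}(\Omega)\cdot\sigma(r),$$ $$\pi_{T,S}(\Theta)T(q)=T(\Theta(q)),\qquad \chi_{S,T}(\Omega)\cdot S(p)=S(\Omega(p))$$ for $r\in R$, $p\in P$, $q\in Q$, $\Omega\in\mathcal{F}_Q(P)$ and $\Theta\in\mathcal{F}_P(Q)$. If $\Omega\in\mathcal{F}_Q(P)$ is the adjoint of $\Theta\in\mathcal{F}_P(Q)$, then $\pi_{T,S}(\Theta)=\chi_{S,T}(\Omega)$. Moreover $\pi_{T,S}(\mathcal{F}_P(Q))=\chi_{S,T}(\mathcal{F}_Q(P))=\operatorname{span}\{T(q)S(p):q\in Q,\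 p\in P\}$, and if $\sigma$ is injective, then $\pi_{T,S}$ and $\chi_{S,T}$ are injective too.
   Context: Rings are associative, not necessarily unital. For $R$-bimodules $P,Q$, $P\otimes Q$ is the $R$-balanced tensor product. ''Linear'' means additive and ''span'' means additive span. For a ring $B$, $B^{op}$ is the opposite ring and $a\cdot b=ba$ denotes the product of $a,b$ in $B^{op}$; products written by juxtaposition of elements of $B$ are in $B$. An $R$-system is a triple $(P,Q,\psi)$ where $P,Q$ are $R$-bimodules and $\psi:P\otimes Q\to R$ is an $R$-bimodule homomorphism. A covariant representation of $(P,Q,\psi)$ is a quadruple $(S,T,\sigma,B)$ where $B$ is a ring, $S:P\to B$ and $T:Q\to B$ are linear maps, $\sigma:R\to B$ is a ring homomorphism, and $S(pr)=S(p)\sigma(r)$, $S(rp)=\sigma(r)S(p)$, $T(qr)=T(q)\sigma(r)$, $T(rq)=\sigma(r)T(q)$, $\sigma(\psi(p\otimes q))=S(p)T(q)$ for all $r\in R,p\in P,q\in Q$. For $p\in P,q\in Q$: $\theta_{q,p}:Q\to Q$ is the right $R$-module map $x\mapsto q\psi(p\otimes x)$ and $\theta_{p,q}:P\to P$ is the left $R$-module map $y\mapsto\psi(y\otimes q)p$. $\mathcal{F}_P(Q)$ is the additive span of all $\theta_{q,p}$, and $\mathcal{F}_Q(P)$ the additive span of all $\theta_{p,q}$; both are rings under composition. A left $R$-module map $\Omega:P\to P$ is an adjoint of a right $R$-module map $\Theta:Q\to Q$ if $\psi(p\otimes\Theta(q))=\psi(\Omega(p)\otimes q)$ for all $p\in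 P,q\in Q$ (under condition (FS) adjoints are unique); $\theta_{p,q}$ is an adjoint of $\theta_{q,p}$. For $r\in R$, $\Delta(r):Q\to Q$ is $q\mapsto rq$ and $\Gamma(r):P\to P$ is $p\mapsto pr$. Products such as $\Delta(r)\Theta$ and $\Gamma(r)\Omega$ are compositions of maps. Condition (FS): for all finite sets $\{q_1,\dots,q_n\}\subseteq Q$ and $\{p_1,\dots,p_m\}\subseteq P$ there exist $\Theta\in\mathcal{F}_P(Q)$ and $\Omega\in\mathcal{F}_Q(P)$ with $\Theta(q_i)=q_i$ for all $i$ and $\Omega(p_j)=p_j$ for all $j$. *)

(* Defs.v *)
From HB Require Import structures.
From mathcomp Require Import all_boot all_order all_algebra.
From mathcomp Require Import boolp classical_sets functions.
From mathcomp Require Import generic_quotient ring_quotient.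
From mathcomp.multinomials Require Import freeg.

Set Implicit Arguments.
Unset Strict Implicit.
Unset Printing Implicit Defensive.

Import GRing.Theory.

Local Open Scope classical_set_scope.
Local Open Scope quotient_scope.
Local Open Scope ring_scope.

Declare Scope rng_scope.

(* Rings not necessarily unital; every MathComp ring structure has a unit. *)
HB.mixin Record Zmodule_isRng A of GRing.Zmodule A := {
  rngmul : A -> A -> A;
  rngmulA : associative rngmul;
  rngmulDl : left_distributive rngmul +%R;
  rngmulDr : right_distributive rngmul +%R;
}.

#[short(type="rngType")]
HB.structure Definition Rng := {A of Zmodule_isRng A & GRing.Zmodule A}.

Notation "x * y" := (rngmul x y) : rng_scope.
Local Open Scope rng_scope.

HB.mixin Record isRngMorphism (A B : rngType) (f : A -> B) := {
  rng_morphM : {morph f : x y / x * y}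
}.

HB.structure Definition RngMorphism (A B : rngType) :=
  {f of isRngMorphism A B f & @GRing.Additive A B f}.

Notation "{ 'rng_hom' A -> B }" := (RngMorphism.type A%type B%type)
  (at level 0, A at level 98, B at level 99,
   format "{ 'rng_hom'  A  ->  B }") : type_scope.

Definition opmul (A : rngType) (x y : A) : A := y * x.

Notation "x *op y" := (opmul x y) (at level 40, left associativity) : rng_scope.

(* The opposite ring, on the same carrier; its product is _ *op _. *)
Definition rng_op (A : Type) : Type := A.

Section OppositeRng.
Variable A : rngType.

HB.instance Definition _ := GRing.Zmodule.on (rng_op A).

Fact opmulA : associative (@opmul A).
Proof. by move=> x y z; rewrite /opmul rngmulA. Qed.

Fact opmulDl : left_distributive (@opmul A) +%R.
Proof. by move=> x y z; apply: rngmulDr. Qed.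

Fact opmulDr : right_distributive (@opmul A) +%R.
Proof. by move=> x y z; apply: rngmulDl. Qed.

HB.instance Definition _ :=
  @Zmodule_isRng.Build (rng_op A) (@opmul A) opmulA opmulDl opmulDr.

Lemma rng_opE (x y : rng_op A) : x * y = (x : A) *op (y : A).
Proof. by []. Qed.

End OppositeRng.

HB.mixin Record Zmodule_isBimodule (R : rngType) V of GRing.Zmodule V := {
  lact : R -> V -> V;
  ract : V -> R -> V;
  lactA : forall r s v, lact r (lact s v) = lact (r * s) v;
  lactDl : forall r s v, lact (r + s) v = lact r v + lact s v;
  lactDr : forall r v w, lact r (v + w) = lact r v + lact r w;
  ractA : forall v r s, ract (ract v r) s = ract v (r * s);
  ractDl : forall v w r, ract (v + w) r = ract v r + ract w r;
  ractDr : forall v r s, ract v (r + s) = ract v r + ract v s;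
  lractA : forall r v s, ract (lact r v) s = lact r (ract v s);
}.

#[short(type="bimodType")]
HB.structure Definition Bimodule (R : rngType) :=
  {V of Zmodule_isBimodule R V & GRing.Zmodule V}.

Notation "r *: v" := (lact r v) : rng_scope.
Notation "v :* r" := (ract v r) : rng_scope.

HB.mixin Record isBimodMorphism (R : rngType) (V W : bimodType R)
    (f : V -> W) := {
  bimod_morphZl : forall r v, f (r *: v) = r *: f v;
  bimod_morphZr : forall v r, f (v :* r) = f v :* r;
}.

HB.structure Definition BimodMorphism (R : rngType) (V W : bimodType R) :=
  {f of isBimodMorphism R V W f & @GRing.Additive V W f}.

Notation "{ 'bimod' V -> W }" := (BimodMorphism.type V%type W%type)
  (at level 0, V at level 98, W at level 99,
   format "{ 'bimod'  V  ->  W }") : type_scope.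

(* R as a bimodule over itself. *)
Definition rng_regular (A : Type) : Type := A.
Notation "R ^reg" := (rng_regular R) (at level 2, format "R ^reg") : type_scope.

Section RegularBimodule.
Variable R : rngType.

HB.instance Definition _ := GRing.Zmodule.on R^reg.

Let mul : R -> R -> R := fun x y => x * y.

Fact reg_lactA r s v : mul r (mul s v) = mul (r * s) v.
Proof. exact: rngmulA. Qed.
Fact reg_ractA v r s : mul (mul v r) s = mul v (r * s).
Proof. by rewrite /mul rngmulA. Qed.
Fact reg_lractA r v s : mul (mul r v) s = mul r (mul v s).
Proof. by rewrite /mul rngmulA. Qed.

HB.instance Definition _ := @Zmodule_isBimodule.Build R R^reg mul mul
  reg_lactA (fun r s v => rngmulDl r s v) (fun r v w => rngmulDr r v w)
  reg_ractA (fun v w r => rngmulDl v w r) (fun v r s => rngmulDr v r s)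
  reg_lractA.

End RegularBimodule.

Section AdditiveSpan.
Variables (V : zmodType) (A : set V).

Definition addspan : set V :=
  [set v | exists s : seq (int * V),
     (forall x, x \in s -> A x.2) /\ v = \sum_(x <- s) x.2 *~ x.1].

Lemma addspan_gen v : A v -> addspan v.
Proof.
move=> Av; exists [:: (1, v)]; split; last by rewrite big_seq1 mulr1z.
by move=> x /[!inE] /eqP ->.
Qed.

Lemma addspan_zmod_closed :
  addspan 0 /\ forall x y, addspan x -> addspan y -> addspan (x - y).
Proof.
split; first by exists [::]; split=> //; rewrite big_nil.
move=> _ _ [s [As ->]] [t [At ->]].
exists (s ++ [seq (- x.1, x.2) | x <- t]); split.
  move=> x; rewrite mem_cat => /orP[/As//|/mapP[y /At Ay ->]//].
rewrite big_cat big_map /=; congr (_ + _).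
by rewrite -sumrN; apply: eq_bigr => x _; rewrite mulrNz.
Qed.

Lemma addspan_ind (M : set V) :
  M 0 -> (forall x y, M x -> M y -> M (x - y)) -> A `<=` M -> addspan `<=` M.
Proof.
move=> M0 MB AM.
have MN x : M x -> M (- x) by move=> Mx; rewrite -sub0r; apply: MB.
have MD x y : M x -> M y -> M (x + y).
  by move=> Mx My; rewrite -[y]opprK; apply: MB => //; apply: MN.
have Mn x n : M x -> M (x *+ n).
  by move=> Mx; elim: n => [|n IH]; rewrite ?mulr0n // mulrS; apply: MD.
have Mz x (c : int) : M x -> M (x *~ c).
  case: c => n Mx; first exact: Mn.
  by apply: MN; apply: Mn.
move=> _ [s [As ->]].
elim: s As => [|x s IH] As; first by rewrite big_nil.
rewrite big_cons; apply: MD.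
  by apply: Mz; apply: AM; apply: As; rewrite mem_head.
by apply: IH => y ys; apply: As; rewrite inE ys orbT.
Qed.

Definition addspan_pred : {pred V} := fun v => `[< addspan v >].

Fact addspan_pred_closed : zmod_closed addspan_pred.
Proof.
have [s0 sB] := addspan_zmod_closed.
split; first exact/asboolP.
by move=> x y /asboolP sx /asboolP sy; apply/asboolP/sB.
Qed.

HB.instance Definition _ := GRing.isZmodClosed.Build V addspan_pred
  addspan_pred_closed.

End AdditiveSpan.

(* The R-balanced tensor product: the free abelian group on P x Q modulo the
   subgroup generated by the biadditivity and balancing relations. *)
Section Tensor.
Variables (R : rngType) (P Q : bimodType R).

Local Notation free := {freeg (P * Q)%type / int}.

Inductive tensor_relation : set free :=
| Tensor_addl p p' q :
    tensor_relation (<< (p + p', q) >> - (<< (p, q) >> + << (p', q) >>))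
| Tensor_addr p q q' :
    tensor_relation (<< (p, q + q') >> - (<< (p, q) >> + << (p, q') >>))
| Tensor_balance p r q :
    tensor_relation (<< (p :* r, q) >> - << (p, r *: q) >>).

Definition tensor : Type := Quotient.quot (addspan_pred tensor_relation).

HB.instance Definition _ := GRing.Zmodule.on tensor.

Definition tens (p : P) (q : Q) : tensor :=
  \pi_(Quotient.quot (addspan_pred tensor_relation)) << (p, q) >>.

Definition biadditive (M : zmodType) (f : P -> Q -> M) : Prop :=
  (forall p p' q, f (p + p') q = f p q + f p' q) /\
  (forall p q q', f p (q + q') = f p q + f p q').

Definition balanced (M : zmodType) (f : P -> Q -> M) : Prop :=
  forall p r q, f (p :* r) q = f p (r *: q).

Lemma eq_tensor (x y : free) : addspan tensor_relation (x - y) ->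
  \pi_(Quotient.quot (addspan_pred tensor_relation)) x = \pi y.
Proof.
move=> xy; apply/eqP; rewrite -Quotient.idealrBE.
exact/asboolP.
Qed.

Lemma tens_biadditive : biadditive tens.
Proof.
split=> [p p' q|p q q']; rewrite /tens -raddfD /=; apply: eq_tensor;
  by apply: addspan_gen; constructor.
Qed.

Lemma tens_balanced : balanced tens.
Proof. by move=> p r q; apply: eq_tensor; apply: addspan_gen; constructor. Qed.

Lemma tensor_ind (X : set tensor) :
  X 0 -> (forall x y, X x -> X y -> X (x - y)) -> (forall p q, X (tens p q)) ->
  forall x, X x.
Proof.
move=> X0 XB Xt; elim/quotW => x; rewrite -[x]freeg_sumE raddf_sum /=.
have XN y : X y -> X (- y) by move=> Xy; rewrite -sub0r; apply: XB.
have XD y z : X y -> X z -> X (y + z).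
  by move=> Xy Xz; rewrite -[z]opprK; apply: XB => //; apply: XN.
elim/big_ind: _ => // -[p q] _; rewrite -[coeff _ _]intz -freegU_mulz.
rewrite raddfMz /= -/(tens p q).
have Xn n : X (tens p q *+ n).
  by elim: n => [|n IH]; rewrite ?mulr0n // mulrS; apply: XD.
by case: (coeff _ _) => n; rewrite ?NegzE ?mulrNz; [|apply: XN]; apply: Xn.
Qed.

Lemma eq_tensor_additive (M : zmodType) (f g : {additive tensor -> M}) :
  (forall p q, f (tens p q) = g (tens p q)) -> f =1 g.
Proof.
move=> fg; apply: tensor_ind => //; first by rewrite !raddf0.
by move=> x y fx fy; rewrite !raddfB fx fy.
Qed.

Definition tensor_lift (M : zmodType) (f : P -> Q -> M) (x : tensor) : M :=
  fglift (fun pq : P * Q => f pq.1 pq.2 : zmodule M) (repr x).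

Section Lift.
Variables (M : zmodType) (f : P -> Q -> M).

Let fl : free -> M := fglift (fun pq : P * Q => f pq.1 pq.2 : zmodule M).

Let flB x y : fl (x - y) = fl x - fl y.
Proof. exact: (@lift_is_additive int _ (zmodule M)). Qed.

Let fl1 p q : fl << (p, q) >> = f p q.
Proof. by rewrite /fl liftU scale1r. Qed.

Lemma tensor_lift_pi : biadditive f -> balanced f ->
  forall x : free, tensor_lift f (\pi x) = fl x.
Proof.
move=> [fDl fDr] fbal x.
have -> : tensor_lift f (\pi x) = fl (repr (\pi_tensor x)) by [].
apply/eqP.
have fl0 : fl 0 = 0 by have := flB 0 0; rewrite !subrr.
have flD y z : fl (y + z) = fl y + fl z.
  by rewrite -[z in LHS]opprK flB -[- z]sub0r flB fl0 sub0r opprK.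
rewrite -subr_eq0 -flB; apply/eqP.
apply: (@addspan_ind _ tensor_relation [set y | fl y = 0]) => //=.
- by move=> y z fy fz; rewrite flB fy fz subrr.
- by move=> _ [p p' q|p q q'|p r q] /=;
    rewrite flB ?flD !fl1 ?fDl ?fDr ?fbal subrr.
- apply/asboolP.
  have := Quotient.idealrBE (addspan_pred tensor_relation)
            (repr (\pi_(tensor) x : tensor)) x.
  by rewrite reprK eqxx.
Qed.

Lemma tensor_lift_tens : biadditive f -> balanced f ->
  forall p q, tensor_lift f (tens p q) = f p q.
Proof. by move=> f2 fb p q; rewrite tensor_lift_pi. Qed.

Lemma tensor_lift_additive : biadditive f -> balanced f ->
  zmod_morphism (tensor_lift f).
Proof.
move=> f2 fb; elim/quotW=> x; elim/quotW=> y.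
by rewrite -raddfB /= !tensor_lift_pi.
Qed.

End Lift.

Let tens_l (r : R) p q := tens (r *: p) q.
Let tens_r (r : R) p q := tens p (q :* r).

Fact tens_l_biadditive r : biadditive (tens_l r).
Proof.
have [tDl tDr] := tens_biadditive.
by split=> *; rewrite /tens_l ?lactDr ?tDl ?tDr.
Qed.

Fact tens_l_balanced r : balanced (tens_l r).
Proof. by move=> p s q; rewrite /tens_l -lractA tens_balanced. Qed.

Fact tens_r_biadditive r : biadditive (tens_r r).
Proof.
have [tDl tDr] := tens_biadditive.
by split=> *; rewrite /tens_r ?ractDl ?tDl ?tDr.
Qed.

Fact tens_r_balanced r : balanced (tens_r r).
Proof. by move=> p s q; rewrite /tens_r lractA tens_balanced. Qed.

Definition tensor_lact (r : R) (x : tensor) : tensor :=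
  tensor_lift (fun p q => tens (r *: p) q) x.

Definition tensor_ract (x : tensor) (r : R) : tensor :=
  tensor_lift (fun p q => tens p (q :* r)) x.

Lemma tensor_lact_tens r p q : tensor_lact r (tens p q) = tens (r *: p) q.
Proof.
exact: (tensor_lift_tens (tens_l_biadditive r) (tens_l_balanced r)).
Qed.

Lemma tensor_ract_tens r p q : tensor_ract (tens p q) r = tens p (q :* r).
Proof.
exact: (tensor_lift_tens (tens_r_biadditive r) (tens_r_balanced r)).
Qed.

Fact tensor_lact_additive r : zmod_morphism (tensor_lact r).
Proof.
exact: (tensor_lift_additive (tens_l_biadditive r) (tens_l_balanced r)).
Qed.

Fact tensor_ract_additive r : zmod_morphism (tensor_ract^~ r).
Proof.
exact: (tensor_lift_additive (tens_r_biadditive r) (tens_r_balanced r)).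
Qed.

Let tensor_lactB r (x y : tensor) :
  tensor_lact r (x - y) = tensor_lact r x - tensor_lact r y.
Proof. exact: tensor_lact_additive. Qed.

Let tensor_lact0 r : tensor_lact r 0 = 0.
Proof. by have := tensor_lactB r 0 0; rewrite !subrr. Qed.

Let tensor_lactD r (x y : tensor) :
  tensor_lact r (x + y) = tensor_lact r x + tensor_lact r y.
Proof.
by rewrite -[y in LHS]opprK -[- y]sub0r !tensor_lactB tensor_lact0 sub0r opprK.
Qed.

Let tensor_ractB (x y : tensor) r :
  tensor_ract (x - y) r = tensor_ract x r - tensor_ract y r.
Proof. exact: tensor_ract_additive. Qed.

Let tensor_ract0 r : tensor_ract 0 r = 0.
Proof. by have := tensor_ractB 0 0 r; rewrite !subrr. Qed.

Let tensor_ractD (x y : tensor) r :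
  tensor_ract (x + y) r = tensor_ract x r + tensor_ract y r.
Proof.
by rewrite -[y in LHS]opprK -[- y]sub0r !tensor_ractB tensor_ract0 sub0r opprK.
Qed.

Let addBB (x y z t : tensor) : (x - y) + (z - t) = (x + z) - (y + t).
Proof. by rewrite opprD addrACA. Qed.

Fact tensor_lactA r s x :
  tensor_lact r (tensor_lact s x) = tensor_lact (r * s) x.
Proof.
move: x; apply: tensor_ind => [|x y|p q]; first by rewrite !tensor_lact0.
  by move=> ex ey; rewrite !tensor_lactB ex ey.
by rewrite !tensor_lact_tens lactA.
Qed.

Fact tensor_lactDl r s x :
  tensor_lact (r + s) x = tensor_lact r x + tensor_lact s x.
Proof.
move: x; apply: tensor_ind => [|x y|p q]; first by rewrite !tensor_lact0 addr0.
  by move=> ex ey; rewrite !tensor_lactB ex ey addBB.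
by rewrite !tensor_lact_tens lactDl tens_biadditive.1.
Qed.

Fact tensor_ractA x r s :
  tensor_ract (tensor_ract x r) s = tensor_ract x (r * s).
Proof.
move: x; apply: tensor_ind => [|x y|p q]; first by rewrite !tensor_ract0.
  by move=> ex ey; rewrite !tensor_ractB ex ey.
by rewrite !tensor_ract_tens ractA.
Qed.

Fact tensor_ractDr x r s :
  tensor_ract x (r + s) = tensor_ract x r + tensor_ract x s.
Proof.
move: x; apply: tensor_ind => [|x y|p q]; first by rewrite !tensor_ract0 addr0.
  by move=> ex ey; rewrite !tensor_ractB ex ey addBB.
by rewrite !tensor_ract_tens ractDr tens_biadditive.2.
Qed.

Fact tensor_lractA r x s :
  tensor_ract (tensor_lact r x) s = tensor_lact r (tensor_ract x s).
Proof.
move: x; apply: tensor_ind => [|x y|p q].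
- by rewrite tensor_ract0 !tensor_lact0 tensor_ract0.
- move=> ex ey.
  by rewrite tensor_ractB !tensor_lactB tensor_ractB ex ey.
- by rewrite tensor_lact_tens !tensor_ract_tens tensor_lact_tens.
Qed.

HB.instance Definition _ := @Zmodule_isBimodule.Build R tensor
  tensor_lact tensor_ract
  tensor_lactA tensor_lactDl tensor_lactD
  tensor_ractA tensor_ractD tensor_ractDr tensor_lractA.

Lemma lact_tens r p q : r *: tens p q = tens (r *: p) q.
Proof. exact: tensor_lact_tens. Qed.

Lemma ract_tens p q r : tens p q :* r = tens p (q :* r).
Proof. exact: tensor_ract_tens. Qed.

End Tensor.

Notation "p ⊗ q" := (tens p q) (at level 40, left associativity) : rng_scope.
Notation "P ⊗ Q" := (tensor P Q) (at level 40, left associativity) : type_scope.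

Section System.
Variables (R : rngType) (P Q : bimodType R) (psi : {bimod P ⊗ Q -> R^reg}).

Definition right_module_map (V W : bimodType R) (f : V -> W) : Prop :=
  {morph f : x y / x + y} /\ (forall x r, f (x :* r) = f x :* r).

Definition left_module_map (V W : bimodType R) (f : V -> W) : Prop :=
  {morph f : x y / x + y} /\ (forall r x, f (r *: x) = r *: f x).

Definition theta_fun (q : Q) (p : P) : Q -> Q := fun x => q :* psi (p ⊗ x).

Definition cotheta_fun (p : P) (q : Q) : P -> P := fun y => psi (y ⊗ q) *: p.

(* FPQ is F_P(Q), made of maps Q -> Q; FQP is F_Q(P), made of maps P -> P. *)
Definition FPQ_gen : set (Q -> Q) := [set f | exists q p, f = theta_fun q p].

Definition FQP_gen : set (P -> P) := [set f | exists p q, f = cotheta_fun p q].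

Record FPQ := MkFPQ {
  FPQ_map :> Q -> Q;
  FPQ_spanP : FPQ_map \in addspan_pred FPQ_gen
}.

Record FQP := MkFQP {
  FQP_map :> P -> P;
  FQP_spanP : FQP_map \in addspan_pred FQP_gen
}.

HB.instance Definition _ := [isSub for FPQ_map].
HB.instance Definition _ := [Choice of FPQ by <:].
HB.instance Definition _ := [SubChoice_isSubZmodule of FPQ by <:].

HB.instance Definition _ := [isSub for FQP_map].
HB.instance Definition _ := [Choice of FQP by <:].
HB.instance Definition _ := [SubChoice_isSubZmodule of FQP by <:].

Lemma psiZl r x : psi (r *: x) = (r : R) * psi x.
Proof. exact: bimod_morphZl. Qed.

Lemma psiZr x r : psi (x :* r) = (psi x : R) * r.
Proof. exact: bimod_morphZr. Qed.

Lemma psiDl p p' q : psi ((p + p') ⊗ q) = psi (p ⊗ q) + psi (p' ⊗ q).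
Proof. by rewrite (tens_biadditive P Q).1 raddfD. Qed.

Lemma psiDr p q q' : psi (p ⊗ (q + q')) = psi (p ⊗ q) + psi (p ⊗ q').
Proof. by rewrite (tens_biadditive P Q).2 raddfD. Qed.

Section ModuleMapClosure.
Variables V W : bimodType R.

Lemma right_module_map0 : right_module_map (0 : V -> W).
Proof.
split=> [x y|x r]; first by rewrite addr0.
by apply: (addrI (0 :* r)); rewrite -ractDl !addr0.
Qed.

Lemma right_module_mapB (f g : V -> W) :
  right_module_map f -> right_module_map g -> right_module_map (f - g).
Proof.
move=> [fD fZ] [gD gZ]; have E x : (f - g) x = f x - g x by [].
split=> [x y|x r]; rewrite !E.
  by rewrite fD gD opprD addrACA.
rewrite fZ gZ; apply: (addIr (g x :* r)).
by rewrite subrK -ractDl subrK.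
Qed.

Lemma left_module_map0 : left_module_map (0 : V -> W).
Proof.
split=> [x y|r x]; first by rewrite addr0.
by apply: (addrI (r *: 0)); rewrite -lactDr !addr0.
Qed.

Lemma left_module_mapB (f g : V -> W) :
  left_module_map f -> left_module_map g -> left_module_map (f - g).
Proof.
move=> [fD fZ] [gD gZ]; have E x : (f - g) x = f x - g x by [].
split=> [x y|r x]; rewrite !E.
  by rewrite fD gD opprD addrACA.
rewrite fZ gZ; apply: (addIr (r *: g x)).
by rewrite subrK -lactDr subrK.
Qed.

End ModuleMapClosure.

Lemma theta_fun_module_map q p : right_module_map (theta_fun q p).
Proof.
split=> [x y|x r]; rewrite /theta_fun; first by rewrite psiDr ractDr.
by rewrite -ract_tens psiZr ractA.
Qed.

Lemma cotheta_fun_module_map p q : left_module_map (cotheta_fun p q).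
Proof.
split=> [x y|r x]; rewrite /cotheta_fun; first by rewrite psiDl lactDl.
by rewrite -lact_tens psiZl lactA.
Qed.

Lemma FPQ_module_map (f : FPQ) : right_module_map f.
Proof.
case: f => f /= /asboolP; apply: addspan_ind.
- exact: right_module_map0.
- exact: right_module_mapB.
- by move=> _ [q [p ->]]; apply: theta_fun_module_map.
Qed.

Lemma FQP_module_map (f : FQP) : left_module_map f.
Proof.
case: f => f /= /asboolP; apply: addspan_ind.
- exact: left_module_map0.
- exact: left_module_mapB.
- by move=> _ [p [q ->]]; apply: cotheta_fun_module_map.
Qed.

Definition Delta (r : R) : Q -> Q := fun q => r *: q.

Definition Gamma (r : R) : P -> P := fun p => p :* r.

Section SpanComp.
Variables (V : zmodType) (A : set (V -> V)).

Lemma addspan_compr (g f : V -> V) :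
  (forall h, A h -> addspan A (h \o g)) -> addspan A f -> addspan A (f \o g).
Proof.
move=> Ag; have [s0 sB] := addspan_zmod_closed A.
suff: addspan A `<=` [set f : V -> V | addspan A (f \o g)] by apply.
apply: addspan_ind => //= h k.
exact: sB.
Qed.

Lemma addspan_compl (g f : V -> V) : {morph g : x y / x + y} ->
  (forall h, A h -> addspan A (g \o h)) -> addspan A f -> addspan A (g \o f).
Proof.
move=> gD Ag; have [s0 sB] := addspan_zmod_closed A.
have g0 : g 0 = 0 by apply: (addrI (g 0)); rewrite -gD !addr0.
have gB x y : g (x - y) = g x - g y.
  by apply: (addIr (g y)); rewrite -gD !subrK.
suff: addspan A `<=` [set f : V -> V | addspan A (g \o f)] by apply.
apply: addspan_ind => //=.
  by rewrite (_ : g \o _ = 0) //; apply/funext => x /=.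
move=> h k sh sk; rewrite (_ : g \o _ = (g \o h) - (g \o k)); first exact: sB.
by apply/funext => x /=; rewrite gB.
Qed.

End SpanComp.

Lemma FPQ_gen_span q p : addspan FPQ_gen (theta_fun q p).
Proof. by apply: addspan_gen; exists q, p. Qed.

Lemma FQP_gen_span p q : addspan FQP_gen (cotheta_fun p q).
Proof. by apply: addspan_gen; exists p, q. Qed.

Fact theta_span q p : theta_fun q p \in addspan_pred FPQ_gen.
Proof. exact/asboolP/FPQ_gen_span. Qed.

Fact cotheta_span p q : cotheta_fun p q \in addspan_pred FQP_gen.
Proof. exact/asboolP/FQP_gen_span. Qed.

Definition theta (q : Q) (p : P) : FPQ := MkFPQ (theta_span q p).

Definition cotheta (p : P) (q : Q) : FQP := MkFQP (cotheta_span p q).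

Lemma comp_theta (f : Q -> Q) q p : right_module_map f ->
  f \o theta_fun q p = theta_fun (f q) p.
Proof. by move=> [_ fZ]; apply/funext => x /=; rewrite /theta_fun fZ. Qed.

Lemma comp_cotheta (f : P -> P) p q : left_module_map f ->
  f \o cotheta_fun p q = cotheta_fun (f p) q.
Proof. by move=> [_ fZ]; apply/funext => x /=; rewrite /cotheta_fun fZ. Qed.

Lemma Delta_module_map r : right_module_map (Delta r).
Proof. by split=> [x y|x s]; rewrite /Delta (lactDr, lractA). Qed.

Lemma Gamma_module_map r : left_module_map (Gamma r).
Proof. by split=> [x y|s x]; rewrite /Gamma (ractDl, lractA). Qed.

Lemma theta_Delta q p r : theta_fun q p \o Delta r = theta_fun q (p :* r).
Proof. by apply/funext => x; rewrite /theta_fun /Delta /= tens_balanced. Qed.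

Lemma cotheta_Gamma p q r : cotheta_fun p q \o Gamma r = cotheta_fun p (r *: q).
Proof. by apply/funext => x; rewrite /cotheta_fun /Gamma /= tens_balanced. Qed.

Fact FPQ_compl_span (g : Q -> Q) (f : FPQ) : right_module_map g ->
  g \o f \in addspan_pred FPQ_gen.
Proof.
move=> gm; apply/asboolP; apply: addspan_compl; first by case: gm.
  by move=> _ [q [p ->]]; rewrite comp_theta //; apply: FPQ_gen_span.
by apply/asboolP; case: f.
Qed.

Fact FQP_compl_span (g : P -> P) (f : FQP) : left_module_map g ->
  g \o f \in addspan_pred FQP_gen.
Proof.
move=> gm; apply/asboolP; apply: addspan_compl; first by case: gm.
  by move=> _ [q [p ->]]; rewrite comp_cotheta //; apply: FQP_gen_span.
by apply/asboolP; case: f.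
Qed.

Fact FPQ_compr_Delta_span (f : FPQ) r : f \o Delta r \in addspan_pred FPQ_gen.
Proof.
apply/asboolP; apply: addspan_compr.
  by move=> _ [q [p ->]]; rewrite theta_Delta; apply: FPQ_gen_span.
by apply/asboolP; case: f.
Qed.

Fact FQP_compr_Gamma_span (f : FQP) r : f \o Gamma r \in addspan_pred FQP_gen.
Proof.
apply/asboolP; apply: addspan_compr.
  by move=> _ [p [q ->]]; rewrite cotheta_Gamma; apply: FQP_gen_span.
by apply/asboolP; case: f.
Qed.

(* Delta r and Gamma r need not belong to FPQ and FQP, but their composites
   with elements of FPQ and FQP do. *)
Definition FPQ_comp (f g : FPQ) : FPQ :=
  MkFPQ (FPQ_compl_span g (FPQ_module_map f)).

Definition FQP_comp (f g : FQP) : FQP :=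
  MkFQP (FQP_compl_span g (FQP_module_map f)).

Definition Delta_comp (r : R) (f : FPQ) : FPQ :=
  MkFPQ (FPQ_compl_span f (Delta_module_map r)).

Definition comp_Delta (f : FPQ) (r : R) : FPQ :=
  MkFPQ (FPQ_compr_Delta_span f r).

Definition Gamma_comp (r : R) (f : FQP) : FQP :=
  MkFQP (FQP_compl_span f (Gamma_module_map r)).

Definition comp_Gamma (f : FQP) (r : R) : FQP :=
  MkFQP (FQP_compr_Gamma_span f r).

Fact FPQ_compA : associative FPQ_comp.
Proof. by move=> f g h; apply: val_inj. Qed.

Fact FPQ_compDl : left_distributive FPQ_comp +%R.
Proof. by move=> f g h; apply: val_inj. Qed.

Fact FPQ_compDr : right_distributive FPQ_comp +%R.
Proof.
move=> f g h; apply/val_inj/funext => x.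
by have [fD _] := FPQ_module_map f; apply: fD.
Qed.

HB.instance Definition _ :=
  Zmodule_isRng.Build FPQ FPQ_compA FPQ_compDl FPQ_compDr.

Fact FQP_compA : associative FQP_comp.
Proof. by move=> f g h; apply: val_inj. Qed.

Fact FQP_compDl : left_distributive FQP_comp +%R.
Proof. by move=> f g h; apply: val_inj. Qed.

Fact FQP_compDr : right_distributive FQP_comp +%R.
Proof.
move=> f g h; apply/val_inj/funext => x.
by have [fD _] := FQP_module_map f; apply: fD.
Qed.

HB.instance Definition _ :=
  Zmodule_isRng.Build FQP FQP_compA FQP_compDl FQP_compDr.

(* The first argument is an adjoint of the second. *)
Definition adjoint (Omega : P -> P) (Theta : Q -> Q) : Prop :=
  [/\ left_module_map Omega, right_module_map Theta &
      forall p q, psi (p ⊗ Theta q) = psi (Omega p ⊗ q)].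

Definition condition_FS : Prop :=
  forall (qs : seq Q) (ps : seq P),
  exists (Theta : FPQ) (Omega : FQP),
    {in qs, forall q, Theta q = q} /\ {in ps, forall p, Omega p = p}.

Record covariant_representation (B : rngType) (S : {additive P -> B})
    (T : {additive Q -> B}) (sigma : {rng_hom R -> B}) : Prop := {
  covS_ract : forall p r, S (p :* r) = S p * sigma r;
  covS_lact : forall r p, S (r *: p) = sigma r * S p;
  covT_ract : forall q r, T (q :* r) = T q * sigma r;
  covT_lact : forall r q, T (r *: q) = sigma r * T q;
  cov_psi : forall p q, sigma (psi (p ⊗ q)) = S p * T q;
}.

End System.

(* Main.v *)
(* Let D be the additive span of the products T q * S p in B. Any b in D can be
   written b = c * b = b * c' with c, c' in D: take Theta and Omega from (FS)
   fixing the finitely many q's and p's that occur in b, and c, c' their images.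
   So b = 0 as soon as b * T q = 0 for all q, or S p * b = 0 for all p. Hence
   an element b of D is determined by the rule b * T q = T (Theta q), which
   defines pi Theta, and likewise by S p * b = S (Omega p), which defines
   chi Omega. Every identity is then checked after multiplication by the T q or
   the S p. *)
Require Import Defs.
From HB Require Import structures.
From mathcomp Require Import all_boot all_order all_algebra.
From mathcomp Require Import boolp classical_sets functions.

Set Implicit Arguments.
Unset Strict Implicit.
Unset Printing Implicit Defensive.

Local Open Scope classical_set_scope.
Local Open Scope ring_scope.
Local Open Scope rng_scope.

Import GRing.Theory.
Delimit Scope rng_scope with rng.

(** * Arithmetic in rings without unit *)

Section RngTheory.
Variable A : rngType.
Implicit Types x y z : A.

Lemma rngmul0l x : 0 * x = 0 :> A.
Proof. by apply: (addrI (0 * x)); rewrite -rngmulDl !addr0. Qed.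

Lemma rngmul0r x : x * 0 = 0 :> A.
Proof. by apply: (addrI (x * 0)); rewrite -rngmulDr !addr0. Qed.

Lemma rngmulBl x y z : (x - y) * z = (x * z)%rng - (y * z)%rng.
Proof. by apply: (addIr (y * z)); rewrite -rngmulDl !subrK. Qed.

Lemma rngmulBr x y z : x * (y - z) = (x * y)%rng - (x * z)%rng.
Proof. by apply: (addIr (x * z)); rewrite -rngmulDr !subrK. Qed.

End RngTheory.

(** A finite-rank map can be a sum of generators in many ways, so a formula on generators is not
    visibly well defined. A graph avoids this: choice picks the values, and functionality forces
    them to respect the operations. *)
Lemma rng_hom_of_graph (A C : rngType) (G : A -> C -> Prop) :
    (forall x, exists z, G x z) ->
    (forall x z z', G x z -> G x z' -> z = z') ->
    (forall x y z t, G x z -> G y t -> G (x - y) (z - t)) ->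
    (forall x y z t, G x z -> G y t -> G (x * y) (z * t)) ->
  exists f : {rng_hom A -> C}, forall x, G x (f x).
Proof.
move=> /choice[f Gf] Gfun GB GM.
have fB : zmod_morphism f by move=> x y; apply: Gfun (Gf _) (GB _ _ _ _ _ _).
have fM : {morph f : x y / x * y}.
  by move=> x y; apply: Gfun (Gf _) (GM _ _ _ _ _ _).
pose fZ := GRing.isZmodMorphism.Build A C f fB.
pose fR := isRngMorphism.Build A C f fM.
pose F : {rng_hom A -> C} := HB.pack f fZ fR.
by exists F.
Qed.

(** * Induction on finite-rank maps and nondegeneracy of [psi] *)

Section FiniteRankInd.
Variables (R : rngType) (P Q : bimodType R) (psi : {bimod P ⊗ Q -> R^reg}).

Lemma FPQ_ind (X : FPQ psi -> Prop) :
    X 0 -> (forall f g, X f -> X g -> X (f - g)) ->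
    (forall q p, X (theta psi q p)) ->
  forall f, X f.
Proof.
move=> X0 XB Xt f.
(* Span induction runs over bare functions, while [X] needs an element of the subtype; the
   existential carries that element along. *)
suff [g [gf Xg]] : exists g : FPQ psi, FPQ_map g = f /\ X g.
  by rewrite -(val_inj gf : g = f).
have /asboolP := FPQ_spanP f.
apply: (@addspan_ind _ _ [set h | exists g, FPQ_map g = h /\ X g]).
- by exists 0.
- move=> _ _ [g [<- Xg]] [h [<- Xh]].
  by exists (g - h); split; last exact: XB.
- by move=> _ [q [p ->]]; exists (theta psi q p).
Qed.

Lemma FQP_ind (X : FQP psi -> Prop) :
    X 0 -> (forall f g, X f -> X g -> X (f - g)) ->
    (forall p q, X (cotheta psi p q)) ->
  forall f, X f.
Proof.
move=> X0 XB Xt f.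
suff [g [gf Xg]] : exists g : FQP psi, FQP_map g = f /\ X g.
  by rewrite -(val_inj gf : g = f).
have /asboolP := FQP_spanP f.
apply: (@addspan_ind _ _ [set h | exists g, FQP_map g = h /\ X g]).
- by exists 0.
- move=> _ _ [g [<- Xg]] [h [<- Xh]].
  by exists (g - h); split; last exact: XB.
- by move=> _ [p [q ->]]; exists (cotheta psi p q).
Qed.

Lemma FPQ_eq_additive (V : zmodType) (f g : {additive FPQ psi -> V}) :
  (forall q p, f (theta psi q p) = g (theta psi q p)) -> f =1 g.
Proof.
move=> fg; apply: FPQ_ind => [|x y fx fy|//]; first by rewrite !raddf0.
by rewrite !raddfB fx fy.
Qed.

Lemma FQP_eq_additive (V : zmodType) (f g : {additive FQP psi -> V}) :
  (forall p q, f (cotheta psi p q) = g (cotheta psi p q)) -> f =1 g.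
Proof.
move=> fg; apply: FQP_ind => [|x y fx fy|//]; first by rewrite !raddf0.
by rewrite !raddfB fx fy.
Qed.

Hypothesis hFS : condition_FS psi.

(** By (FS) some finite-rank map fixes [x], while every [theta psi q p] sends [x] to
    [q :* psi (p ⊗ x)], which vanishes. *)
Lemma psi_nondegenerate_r x : (forall p, psi (p ⊗ x) = 0) -> x = 0.
Proof.
move=> x0; have [f [_ [fx _]]] := hFS [:: x] [::].
rewrite -(fx x (mem_head _ _)).
move: f {fx}; apply: FPQ_ind => [//|f g fx gx|q p] /=.
  by rewrite -[LHS]/(f x - g x) fx gx subrr.
rewrite /theta_fun x0.
by apply: (addrI (q :* (0 : R))); rewrite -ractDr !addr0.
Qed.

Lemma psi_nondegenerate_l y : (forall q, psi (y ⊗ q) = 0) -> y = 0.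
Proof.
move=> y0; have [_ [f [_ fy]]] := hFS [::] [:: y].
rewrite -(fy y (mem_head _ _)).
move: f {fy}; apply: FQP_ind => [//|f g fy gy|p q] /=.
  by rewrite -[LHS]/(f y - g y) fy gy subrr.
rewrite /cotheta_fun y0.
by apply: (addrI ((0 : R) *: p)); rewrite -lactDl !addr0.
Qed.

End FiniteRankInd.

(** * The graphs of the two homomorphisms *)

Section CovariantRepresentation.
Variables (R : rngType) (P Q : bimodType R) (psi : {bimod P ⊗ Q -> R^reg}).
Hypothesis hFS : condition_FS psi.
Variables (B : rngType) (S : {additive P -> B}) (T : {additive Q -> B}).
Variable sigma : {rng_hom R -> B}.
Hypothesis hcov : covariant_representation psi S T sigma.
Implicit Types (b c : B) (p : P) (q : Q) (r : R).
Implicit Types (Theta : FPQ psi) (Omega : FQP psi).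

Local Notation D := (addspan [set T q * S p | q in [set: Q] & p in [set: P]]).

Let D_gen q p : D (T q * S p).
Proof. by apply: addspan_gen; exists q => //; exists p. Qed.

Let D0 : D 0.
Proof. exact: (addspan_zmod_closed _).1. Qed.

Let DB b c : D b -> D c -> D (b - c).
Proof. exact: (addspan_zmod_closed _).2. Qed.

Let D_ind (X : B -> Prop) :
    X 0 -> (forall b c, X b -> X c -> X (b - c)) ->
    (forall q p, X (T q * S p)) ->
  forall b, D b -> X b.
Proof.
by move=> X0 XB Xg; apply: addspan_ind => // _ [q _ [p _ <-]].
Qed.

(** Here [b] may lie outside [D], as [sigma r] does in general; it suffices that it maps the image
    of [T] to itself, since it then only changes the left factor of [T q * S p]. *)
Let D_mull b : (forall q, exists q', b * T q = T q') ->
  forall c, D c -> D (b * c).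
Proof.
move=> bT; apply: D_ind => [|c d Dc Dd|q p]; first by rewrite rngmul0r.
  by rewrite rngmulBr; apply: DB.
by have [q' e] := bT q; rewrite rngmulA e.
Qed.

Let D_mulr b : (forall p, exists p', S p * b = S p') ->
  forall c, D c -> D (c * b).
Proof.
move=> Sb; apply: D_ind => [|c d Dc Dd|q p]; first by rewrite rngmul0l.
  by rewrite rngmulBl; apply: DB.
by have [p' e] := Sb p; rewrite -rngmulA e.
Qed.

(** The rule on [b * T q] fixes [b] only up to elements annihilating every [T q] from the left;
    under (FS), [D] contains no nonzero one, whence the clause [D b]. *)
Definition pi_graph Theta b := D b /\ forall q, b * T q = T (Theta q).

Definition chi_graph Omega b := D b /\ forall p, S p * b = S (Omega p).

(** Covariance turns [S p * T x] into [sigma (psi (p ⊗ x))], which [T] absorbs on the right of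
    [q]. *)
Lemma pi_graph_theta q p : pi_graph (theta psi q p) (T q * S p).
Proof.
split=> // x.
by rewrite -rngmulA -(cov_psi hcov) -(covT_ract hcov).
Qed.

Lemma chi_graph_cotheta p q : chi_graph (cotheta psi p q) (T q * S p).
Proof.
split=> // x.
by rewrite rngmulA -(cov_psi hcov) -(covS_lact hcov).
Qed.

Lemma pi_graphB f g b c :
  pi_graph f b -> pi_graph g c -> pi_graph (f - g) (b - c).
Proof.
move=> [Db fb] [Dc gc]; split=> [|q]; first exact: DB.
by rewrite rngmulBl fb gc -raddfB.
Qed.

Lemma chi_graphB f g b c :
  chi_graph f b -> chi_graph g c -> chi_graph (f - g) (b - c).
Proof.
move=> [Db fb] [Dc gc]; split=> [|p]; first exact: DB.
by rewrite rngmulBr fb gc -raddfB.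
Qed.

Lemma pi_graph_total Theta : exists b, pi_graph Theta b.
Proof.
move: Theta; apply: FPQ_ind => [|f g [b fb] [c gc]|q p].
- by exists 0; split=> // q; rewrite rngmul0l raddf0.
- by exists (b - c); apply: pi_graphB.
- by exists (T q * S p); apply: pi_graph_theta.
Qed.

Lemma chi_graph_total Omega : exists b, chi_graph Omega b.
Proof.
move: Omega; apply: FQP_ind => [|f g [b fb] [c gc]|p q].
- by exists 0; split=> // p; rewrite rngmul0r raddf0.
- by exists (b - c); apply: chi_graphB.
- by exists (T q * S p); apply: chi_graph_cotheta.
Qed.

Lemma pi_graphM f g b c :
  pi_graph f b -> pi_graph g c -> pi_graph (f * g) (b * c).
Proof.
move=> [Db fb] [Dc gc]; split=> [|q]; last by rewrite -rngmulA gc fb.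
by apply: D_mull => // q; exists (f q).
Qed.

(** Right multiplication reverses composition: [S p * (c * b) = S (g p) * b = S (f (g p))]. This is
    why [chi] takes values in the opposite ring. *)
Lemma chi_graphM f g b c :
  chi_graph f b -> chi_graph g c -> chi_graph (f * g) (b *op c).
Proof.
move=> [Db fb] [Dc gc]; split=> [|p]; last by rewrite /opmul rngmulA gc fb.
by apply: D_mulr => // p; exists (f p).
Qed.

Lemma pi_graph_Delta_comp r Theta b :
  pi_graph Theta b -> pi_graph (Delta_comp r Theta) (sigma r * b).
Proof.
move=> [Db fb]; split=> [|q]; last by rewrite -rngmulA fb -(covT_lact hcov).
by apply: D_mull => // q; exists (r *: q); rewrite (covT_lact hcov).
Qed.

Lemma pi_graph_comp_Delta Theta r b :
  pi_graph Theta b -> pi_graph (comp_Delta Theta r) (b * sigma r).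
Proof.
move=> [Db fb]; split=> [|q]; last by rewrite -rngmulA -(covT_lact hcov) fb.
by apply: D_mulr => // p; exists (p :* r); rewrite (covS_ract hcov).
Qed.

Lemma chi_graph_Gamma_comp r Omega b :
  chi_graph Omega b -> chi_graph (Gamma_comp r Omega) (b * sigma r).
Proof.
move=> [Db fb]; split=> [|p]; last by rewrite rngmulA fb -(covS_ract hcov).
by apply: D_mulr => // p; exists (p :* r); rewrite (covS_ract hcov).
Qed.

Lemma chi_graph_comp_Gamma Omega r b :
  chi_graph Omega b -> chi_graph (comp_Gamma Omega r) (sigma r * b).
Proof.
move=> [Db fb]; split=> [|p]; last by rewrite rngmulA -(covS_ract hcov) fb.
by apply: D_mull => // q; exists (r *: q); rewrite (covT_lact hcov).
Qed.

(** * Local units and annihilators in the span *)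

Let D_support b : D b -> exists (qs : seq Q) (ps : seq P),
  (forall c, {in qs, forall q, c * T q = T q} -> c * b = b) /\
  (forall c, {in ps, forall p, S p * c = S p} -> b * c = b).
Proof.
move: b; apply: D_ind => [|b b' [qs [ps [cb bc]]] [qs' [ps' [cb' bc']]]|q p].
- by exists [::], [::]; split=> c _; rewrite ?rngmul0l ?rngmul0r.
(* An element fixing the concatenated lists fixes both terms of the difference. *)
- exists (qs ++ qs'), (ps ++ ps'); split=> c ce.
    by rewrite rngmulBr cb ?cb' // => q qs_q; apply: ce;
      rewrite mem_cat qs_q ?orbT.
  by rewrite rngmulBl bc ?bc' // => p ps_p; apply: ce;
    rewrite mem_cat ps_p ?orbT.
- exists [:: q], [:: p]; split=> c ce.
    by rewrite rngmulA ce ?mem_head.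
  by rewrite -rngmulA ce ?mem_head.
Qed.

Lemma span_local_units b : D b ->
  exists c c', [/\ D c, D c', c * b = b & b * c' = b].
Proof.
move=> /D_support[qs [ps [cb bc]]]; have [f [g [fq gp]]] := hFS qs ps.
have [c [Dc cT]] := pi_graph_total f; have [c' [Dc' Sc']] := chi_graph_total g.
exists c, c'; split=> //; first by apply: cb => q /fq; rewrite cT => ->.
by apply: bc => p /gp; rewrite Sc' => ->.
Qed.

(** Write [b = b * c] with [c] in [D]: each generator [T q * S p] of [c] puts a [T q] right after
    [b]. *)
Lemma span_lannihilator b : D b -> (forall q, b * T q = 0) -> b = 0.
Proof.
move=> /span_local_units[_ [c [_ Dc _ bc]]] bT; rewrite -bc.
move: c Dc {bc}; apply: D_ind => [|c c' cE c'E|q p]; first exact: rngmul0r.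
  by rewrite rngmulBr cE c'E subrr.
by rewrite rngmulA bT rngmul0l.
Qed.

Lemma span_rannihilator b : D b -> (forall p, S p * b = 0) -> b = 0.
Proof.
move=> /span_local_units[c [_ [Dc _ cb _]]] Sb; rewrite -cb.
move: c Dc {cb}; apply: D_ind => [|c c' cE c'E|q p]; first exact: rngmul0l.
  by rewrite rngmulBl cE c'E subrr.
by rewrite -rngmulA Sb rngmul0r.
Qed.

(** The two-sided test serves adjoints, where one element is known through its products with [T q]
    and the other through those with [S p]. *)
Lemma span_annihilator b : D b -> (forall p q, S p * b * T q = 0) -> b = 0.
Proof.
move=> Db SbT; have [c [_ [Dc _ cb _]]] := span_local_units Db.
apply: span_lannihilator => // x; rewrite -cb.
move: c Dc {cb}; apply: D_ind => [|c c' cE c'E|q p].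
- by rewrite !rngmul0l.
- by rewrite !rngmulBl cE c'E subrr.
- by rewrite -!rngmulA [S p * _]rngmulA SbT rngmul0r.
Qed.

(** * Single-valuedness, adjoints and kernels of the graphs *)

Lemma pi_graph_fun Theta b c : pi_graph Theta b -> pi_graph Theta c -> b = c.
Proof.
move=> [Db fb] [Dc fc]; apply/eqP; rewrite -subr_eq0; apply/eqP.
apply: span_lannihilator => [|q]; first exact: DB.
by rewrite rngmulBl fb fc subrr.
Qed.

Lemma chi_graph_fun Omega b c :
  chi_graph Omega b -> chi_graph Omega c -> b = c.
Proof.
move=> [Db fb] [Dc fc]; apply/eqP; rewrite -subr_eq0; apply/eqP.
apply: span_rannihilator => [|p]; first exact: DB.
by rewrite rngmulBr fb fc subrr.
Qed.

(** Both [S p * b * T q] and [S p * c * T q] are values of [sigma], at [psi (p ⊗ Theta q)] and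
    [psi (Omega p ⊗ q)], which adjointness equates. *)
Lemma pi_chi_graph_adjoint Theta Omega b c : adjoint psi Omega Theta ->
  pi_graph Theta b -> chi_graph Omega c -> b = c.
Proof.
move=> [_ _ adj] [Db fb] [Dc gc]; apply/eqP; rewrite -subr_eq0; apply/eqP.
apply: span_annihilator => [|p q]; first exact: DB.
rewrite rngmulBr rngmulBl -rngmulA fb gc.
by rewrite -!(cov_psi hcov) adj subrr.
Qed.

Lemma pi_graph0 Theta : injective sigma -> pi_graph Theta 0 -> Theta = 0.
Proof.
move=> sigma_inj [_ f0]; apply/val_inj/funext => q.
apply: (psi_nondegenerate_r hFS) => p; apply: sigma_inj.
by rewrite (cov_psi hcov) -f0 rngmul0l rngmul0r raddf0.
Qed.

Lemma chi_graph0 Omega : injective sigma -> chi_graph Omega 0 -> Omega = 0.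
Proof.
move=> sigma_inj [_ f0]; apply/val_inj/funext => p.
apply: (psi_nondegenerate_l hFS) => q; apply: sigma_inj.
by rewrite (cov_psi hcov) -f0 rngmul0r rngmul0l raddf0.
Qed.

(** * The homomorphisms and their ranges *)

Lemma pi_hom_exists :
  exists f : {rng_hom FPQ psi -> B}, forall Theta, pi_graph Theta (f Theta).
Proof.
apply: rng_hom_of_graph.
- exact: pi_graph_total.
- exact: pi_graph_fun.
- exact: pi_graphB.
- exact: pi_graphM.
Qed.

Lemma chi_hom_exists :
  exists f : {rng_hom FQP psi -> rng_op B},
    forall Omega, chi_graph Omega (f Omega).
Proof.
(* The explicit codomain makes the product condition the one for [*op]. *)
apply: (@rng_hom_of_graph _ (rng_op B)).
- exact: chi_graph_total.
- exact: chi_graph_fun.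
- exact: chi_graphB.
- exact: chi_graphM.
Qed.

Lemma range_pi_graph (f : {additive FPQ psi -> B}) :
  (forall Theta, pi_graph Theta (f Theta)) -> range f = D.
Proof.
move=> fG; apply/seteqP; split=> [_ [Theta _ <-]|b].
  by have [] := fG Theta.
apply: D_ind => [|_ _ [x _ <-] [y _ <-]|q p].
- by exists 0; rewrite ?raddf0.
- by exists (x - y); rewrite ?raddfB.
- exists (theta psi q p) => //.
  exact: pi_graph_fun (fG _) (pi_graph_theta q p).
Qed.

Lemma range_chi_graph (f : {additive FQP psi -> B}) :
  (forall Omega, chi_graph Omega (f Omega)) -> range f = D.
Proof.
move=> fG; apply/seteqP; split=> [_ [Omega _ <-]|b].
  by have [] := fG Omega.
apply: D_ind => [|_ _ [x _ <-] [y _ <-]|q p].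
- by exists 0; rewrite ?raddf0.
- by exists (x - y); rewrite ?raddfB.
- exists (cotheta psi p q) => //.
  exact: chi_graph_fun (fG _) (chi_graph_cotheta p q).
Qed.

End CovariantRepresentation.

Theorem proposition3p11 (R : rngType) (P Q : bimodType R)
    (psi : {bimod P ⊗ Q -> R^reg}) (hFS : condition_FS psi)
    (B : rngType) (S : {additive P -> B}) (T : {additive Q -> B})
    (sigma : {rng_hom R -> B}) (hcov : covariant_representation psi S T sigma) :
  exists (pi : {rng_hom FPQ psi -> B}) (chi : {rng_hom FQP psi -> rng_op B}),
    [/\ (forall q p, pi (theta psi q p) = T q * S p),
        (forall pi' : {rng_hom FPQ psi -> B},
           (forall q p, pi' (theta psi q p) = T q * S p) -> pi' =1 pi),
        (forall p q, chi (cotheta psi p q) = S p *op T q) &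
        (forall chi' : {rng_hom FQP psi -> rng_op B},
           (forall p q, chi' (cotheta psi p q) = S p *op T q) -> chi' =1 chi)] /\
    [/\ (forall r Theta, pi (Delta_comp r Theta) = sigma r * pi Theta),
        (forall r Theta, pi (comp_Delta Theta r) = pi Theta * sigma r),
        (forall r Omega, chi (Gamma_comp r Omega) = sigma r *op chi Omega) &
        (forall r Omega, chi (comp_Gamma Omega r) = (chi Omega : B) *op sigma r)] /\
    [/\ (forall (Theta : FPQ psi) q, pi Theta * T q = T (Theta q)),
        (forall (Omega : FQP psi) p, (chi Omega : B) *op S p = S (Omega p)) &
        (forall (Theta : FPQ psi) (Omega : FQP psi),
           adjoint psi Omega Theta -> pi Theta = chi Omega)] /\
    [/\ range pi = range chi,
        range pi = addspan [set T q * S p | q in [set: Q] & p in [set: P]] &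
        (injective sigma -> injective pi /\ injective chi)].
Proof.
have [pi piG] := pi_hom_exists hFS hcov.
have [chi chiG] := chi_hom_exists hFS hcov.
(* Each identity for [pi] now reduces to placing its right-hand side in the graph. *)
have piE Theta b : pi_graph S T Theta b -> pi Theta = b.
  exact: (pi_graph_fun hFS hcov) (piG Theta).
have chiE Omega b : chi_graph S T Omega b -> chi Omega = b.
  exact: (chi_graph_fun hFS hcov) (chiG Omega).
have pi_theta q p : pi (theta psi q p) = T q * S p.
  exact/piE/(pi_graph_theta hcov).
have chi_cotheta p q : chi (cotheta psi p q) = S p *op T q.
  exact/chiE/(chi_graph_cotheta hcov).
have pi_range := range_pi_graph hFS hcov (f := pi) piG.
have chi_range := range_chi_graph hFS hcov (f := chi) chiG.
exists pi, chi; split; [split=> //|split; [split|split; split]].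
- move=> pi' pi'E; apply: FPQ_eq_additive => q p.
  exact: etrans (pi'E q p) (esym (pi_theta q p)).
- move=> chi' chi'E; apply: FQP_eq_additive => p q.
  exact: etrans (chi'E p q) (esym (chi_cotheta p q)).
- by move=> r Theta; apply/piE/(pi_graph_Delta_comp hcov).
- by move=> r Theta; apply/piE/(pi_graph_comp_Delta hcov).
- by move=> r Omega; apply/chiE/(chi_graph_Gamma_comp hcov).
- by move=> r Omega; apply/chiE/(chi_graph_comp_Gamma hcov).
- by move=> Theta q; exact: (piG Theta).2.
- by move=> Omega p; exact: (chiG Omega).2.
- move=> Theta Omega adj.
  exact: (pi_chi_graph_adjoint hFS hcov adj (piG _) (chiG _)).
- by rewrite pi_range -chi_range.
- exact: pi_range.
(* Equal values put [0] in the graph over [x - y], so the kernel statements apply. *)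
- move=> sigma_inj; split=> x y exy; apply/eqP; rewrite -subr_eq0; apply/eqP.
    apply: (pi_graph0 hFS hcov sigma_inj).
    by have := pi_graphB (piG x) (piG y); rewrite exy subrr.
  apply: (chi_graph0 hFS hcov sigma_inj).
  by have := chi_graphB (chiG x) (chiG y); rewrite exy subrr.
Qed.
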